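(* For every integer $n\ge 6$, the function $g(n)=\max\{f_1(\mathcal{P}(G)) : G \text{ a graph with } n \text{ vertices}\}$ satisfies \[ \tfrac{1}{54}n^4\le g(n)\le \left(\tfrac{1}{32}+o(1)\right)n^4, \] where $o(1)\to 0$ as $n\to\infty$.
   Context: All graphs are finite, undirected, without loops, multiple edges or isolated vertices. For a graph $G$ on vertex set $[n]$, the edge polytope is $\mathcal{P}(G)=\mathrm{conv}\{e_i+e_j : \{i,j\}\in E(G)\}\subseteq\mathbb{R}^n$, where $e_i$ is the $i$th unit vector. $f_1(P)$ is the number of edges (one-dimensional faces) of a polytope $P$. *)

(* Defs.v *)
From mathcomp Require Import all_boot all_order all_algebra.
From mathcomp Require Import finmap.
From mathcomp Require Import all_classical all_reals all_analysis.

Set Implicit Arguments.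
Unset Strict Implicit.
Unset Printing Implicit Defensive.

Import Order.TTheory GRing.Theory Num.Theory.
Import numFieldNormedType.Exports.

Local Open Scope classical_set_scope.
Local Open Scope ring_scope.

(* A graph on the vertex set 'I_n is given by its set of edges, which are
   2-element sets of vertices (hence no loops and no multiple edges); the second
   conjunct excludes isolated vertices. *)
Definition is_graph (n : nat) (E : {set {set 'I_n}}) : bool :=
  [forall e in E, #|e| == 2%N] && [forall i : 'I_n, [exists e in E, i \in e]].

Definition conv_hull (R : realType) (n : nat) (S : set 'rV[R]_n) :
    set 'rV[R]_n :=
  [set x | exists (k : nat) (p : 'I_k -> 'rV[R]_n) (a : 'I_k -> R),
     [/\ forall i, S (p i), forall i, 0 <= a i, \sum_i a i = 1
       & x = \sum_i a i *: p i]].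

Definition affine_hull (R : realType) (n : nat) (S : set 'rV[R]_n) :
    set 'rV[R]_n :=
  [set x | exists (k : nat) (p : 'I_k -> 'rV[R]_n) (a : 'I_k -> R),
     [/\ forall i, S (p i), \sum_i a i = 1 & x = \sum_i a i *: p i]].

Definition has_dim (R : realType) (n : nat) (S : set 'rV[R]_n) (d : nat) : Prop :=
  exists (x0 : 'rV[R]_n) (U : {vspace 'rV[R]_n}),
    affine_hull S = [set x0 + u | u in [set` U]] /\ \dim U = d.

Definition dotp (R : realType) (n : nat) (c x : 'rV[R]_n) : R :=
  \sum_i c 0 i * x 0 i.

(* As usual, the empty set and P itself count as faces of a polytope P. *)
Definition face (R : realType) (n : nat) (P F : set 'rV[R]_n) : Prop :=
  exists (c : 'rV[R]_n) (b : R),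
    P `<=` [set x | dotp c x <= b] /\ F = P `&` [set x | dotp c x = b].

(* fset_set is only meaningful on finite sets: a polytope has finitely many
   faces. *)
Definition f_vector (R : realType) (n : nat) (P : set 'rV[R]_n) (d : nat) : nat :=
  #|` fset_set [set F | face P F /\ has_dim F d] |.

Definition unit_vec (R : realType) (n : nat) (i : 'I_n) : 'rV[R]_n :=
  delta_mx 0 i.

Definition edge_polytope (R : realType) (n : nat) (E : {set {set 'I_n}}) :
    set 'rV[R]_n :=
  conv_hull [set x | exists i j : 'I_n,
    [set i; j]%SET \in E /\ x = unit_vec R i + unit_vec R j].

Arguments edge_polytope R {n} E.

(* For n >= 2 the maximum ranges over a nonempty set of graphs. *)
Definition max_edges (R : realType) (n : nat) : nat :=
  \max_(E : {set {set 'I_n}} | is_graph E) f_vector (edge_polytope R E) 1.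

(* Main.v *)
(** The edge [conv(x_e, x_f)] is a face of the edge polytope iff [x_e + x_f] is
not the sum of another pair of generators, i.e. iff [e] and [f] are not opposite
edges of a 4-cycle of the graph.  For disjoint [e = ab], [f = cd] in no such
4-cycle, one of the four vertices, say [a], has no neighbour on the other edge,
and the weights [a: 1, b: -1, c, d: 0], [-2] elsewhere, support the segment.

Upper bound: with [S] twice the number of edges of the graph, the number of
ordered pairs of oriented edges is [S^2], and at least [hom(C4) >= S^4 / n^4]
of them (each pair lies on at most two 4-cycles) are opposite in a 4-cycle;
[S^2 - S^4 / n^4 <= n^4 / 4], and each unordered pair is counted 8 times.

Lower bound: in the random graph of density [p = 1 / sqrt 3], two disjoint
pairs of vertices are edges spanning a face with probability
[p^2 (1 - p^2)^2 = 4/27], and two adjacent ones with probability [p^2 = 1/3].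
Hanging the isolated vertices on a covered vertex destroys no face. *)

Require Import Defs.
From mathcomp Require Import all_boot all_order all_algebra.
From mathcomp Require Import finmap.
From mathcomp Require Import all_classical all_reals all_analysis.
From mathcomp Require Import ring lra.
Set Implicit Arguments.
Unset Strict Implicit.
Unset Printing Implicit Defensive.
Import Order.TTheory GRing.Theory Num.Theory.
Import numFieldNormedType.Exports.
Local Open Scope classical_set_scope.
Local Open Scope ring_scope.

(** * Convex hulls, their faces, and sets of dimension one *)

Section ConvexGeometry.
Context {R : realType} {n : nat}.
Implicit Types (S F : set 'rV[R]_n) (c x y z : 'rV[R]_n).

Lemma dotpD c x y : dotp c (x + y) = dotp c x + dotp c y.
Proof. by rewrite -big_split; apply: eq_bigr => i _; rewrite mxE mulrDr. Qed.

Lemma dotp_comb c k (p : 'I_k -> 'rV[R]_n) (a : 'I_k -> R) :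
  dotp c (\sum_i a i *: p i) = \sum_i a i * dotp c (p i).
Proof.
rewrite /dotp; under eq_bigr => i _ do rewrite summxE mulr_sumr.
rewrite exchange_big; apply: eq_bigr => i _; rewrite mulr_sumr.
by apply: eq_bigr => j _; rewrite mxE mulrCA.
Qed.

Lemma conv_hull_gen S x : S x -> conv_hull S x.
Proof.
move=> Sx; exists 1%N, (fun=> x), (fun=> 1).
by split; rewrite ?big_ord1 ?scale1r.
Qed.

Lemma affine_hull_gen S x : S x -> affine_hull S x.
Proof.
move=> Sx; exists 1%N, (fun=> x), (fun=> 1).
by split; rewrite ?big_ord1 ?scale1r.
Qed.

Lemma conv_hull_halfspace S c b :
  S `<=` [set x | dotp c x <= b] -> conv_hull S `<=` [set x | dotp c x <= b].
Proof.
move=> Sb x [k [p [a [Sp a0 a1 ->]]]] /=.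
rewrite dotp_comb -[b]mul1r -a1 mulr_suml.
by apply: ler_sum => i _; apply: ler_wpM2l => //; apply: Sb.
Qed.

(** In a convex combination whose value reaches the maximum [b], the nonnegative defects
    [a i * (b - dotp c (p i))] add up to zero, so only generators on the hyperplane carry weight. *)
Lemma conv_hull_hyperplane S c b :
  S `<=` [set x | dotp c x <= b] ->
  conv_hull S `&` [set x | dotp c x = b] =
  conv_hull (S `&` [set x | dotp c x = b]).
Proof.
move=> Sb; apply/seteqP; split=> x; last first.
  move=> [k [p [a [Sp a0 a1 xE]]]]; split.
    by exists k, p, a; split=> // i; case: (Sp i).
  rewrite /= xE dotp_comb -[b]mul1r -a1 mulr_suml.
  by apply: eq_bigr => i _; case: (Sp i) => _ /= ->.
move=> [[k [p [a [Sp a0 a1 ->]]]]] /= xb.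
have tight i : a i != 0 -> dotp c (p i) = b.
  have : \sum_i a i * (b - dotp c (p i)) = 0.
    under eq_bigr => j _ do rewrite mulrBr.
    by rewrite sumrB -mulr_suml a1 mul1r -dotp_comb xb subrr.
  move/psumr_eq0P => /(_ _ i isT) H ai.
  have /eqP : a i * (b - dotp c (p i)) = 0.
    by apply: H => j _; rewrite mulr_ge0 ?a0// subr_ge0; apply: Sb.
  by rewrite mulf_eq0 (negPf ai) subr_eq0 => /eqP.
(* Points of zero weight may lie off the hyperplane; [p i0] replaces them. *)
have [i0 ai0] : exists i, a i != 0.
  apply/existsP; apply: contraT; rewrite negb_exists => /forallP H.
  have := oner_neq0 R; rewrite -a1 big1 ?eqxx// => i _.
  by move: (H i); rewrite negbK => /eqP.
exists k, (fun i => if a i == 0 then p i0 else p i), a; split=> //.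
  move=> i; case: ifPn => [_|ai]; split; try exact: Sp; exact: tight.
by apply: eq_bigr => i _; case: eqP => // ->; rewrite !scale0r.
Qed.

Lemma affine_comb_mem (U : {vspace 'rV[R]_n}) x k
    (p : 'I_k -> 'rV[R]_n) (a : 'I_k -> R) :
  \sum_i a i = 1 -> (forall i, p i - x \in U) -> \sum_i a i *: p i - x \in U.
Proof.
move=> a1 pU; rewrite -[x]scale1r -a1 scaler_suml -sumrB.
by apply: memv_suml => i _; rewrite -scalerBr memvZ.
Qed.

Lemma has_dim_segment x y : x != y -> has_dim (conv_hull [set x; y]) 1.
Proof.
move=> xy; exists x, <[y - x]>%VS; split; last first.
  by rewrite dim_vline subr_eq0 eq_sym xy.
apply/seteqP; split=> z.
  move=> [k [p [a [pF a1 ->]]]]; exists (\sum_i a i *: p i - x); last first.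
    by rewrite addrC subrK.
  apply: affine_comb_mem => // i.
  have [l [q [b [qS _ b1 ->]]]] := pF i.
  apply: affine_comb_mem => // j.
  by case: (qS j) => ->; rewrite ?subrr ?mem0v ?memv_line.
move=> [_ /vlineP[t ->] <-].
exists 2%N, (fun i => if i == ord0 then x else y),
  (fun i => if i == ord0 then 1 - t else t); split.
- by move=> i; apply: conv_hull_gen; case: ifP => _; [left|right].
- by rewrite !big_ord_recl big_ord0 /= addr0 subrK.
- rewrite !big_ord_recl big_ord0 /= addr0 scalerBr scalerBl scale1r.
  by rewrite addrA addrAC.
Qed.

Lemma has_dim1_line F x y z :
  has_dim F 1 -> F x -> F y -> F z -> x != y -> exists t, z - x = t *: (y - x).
Proof.
move=> [x0 [U [FU U1]]] Fx Fy Fz xy.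
have memU u v : F u -> F v -> v - u \in U.
  move=> /affine_hull_gen + /affine_hull_gen; rewrite FU => -[u' u'U <-] [v' v'U <-].
  by rewrite opprD addrACA subrr add0r memvB.
have/eqP UE : <[y - x]>%VS == U.
  by rewrite eqEdim U1 dim_vline subr_eq0 eq_sym xy andbT -memvE memU.
by apply/vlineP; rewrite UE memU.
Qed.

(** Rules out the empty face and vertices: a one-dimensional affine hull contains both [x0] and
    [x0 + vpick U], which differ. *)
Lemma has_dim1_nontrivial F z : has_dim F 1 -> ~ F `<=` [set z].
Proof.
move=> [x0 [U [FU U1]]] Fz.
have AF : affine_hull F `<=` [set z].
  move=> _ [k [p [a [pF a1 ->]]]] /=.
  rewrite -[RHS]scale1r -a1 scaler_suml.
  by apply: eq_bigr => i _; rewrite (Fz _ (pF i)).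
have/negP[] : vpick U != 0 by rewrite vpick0 -dimv_eq0 U1.
have x0z : x0 = z by apply: AF; rewrite FU; exists 0; rewrite ?addr0//= mem0v.
have : x0 + vpick U = z.
  by apply: AF; rewrite FU; exists (vpick U); rewrite //= memv_pick.
by rewrite x0z => /eqP; rewrite -subr_eq0 addrAC subrr add0r.
Qed.

End ConvexGeometry.

(** * Vertex sets as 0/1 vectors *)

Lemma set2_inj (T : finType) (a b c d : T) :
  [set a; b]%SET = [set c; d]%SET -> (a = c /\ b = d) \/ (a = d /\ b = c).
Proof.
move=> H; have : a \in [set c; d]%SET by rewrite -H !inE eqxx.
have : b \in [set c; d]%SET by rewrite -H !inE eqxx orbT.
have : c \in [set a; b]%SET by rewrite H !inE eqxx.
have : d \in [set a; b]%SET by rewrite H !inE eqxx orbT.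
by rewrite !inE => /orP[]/eqP ? /orP[]/eqP ? /orP[]/eqP ? /orP[]/eqP ?;
  subst; auto.
Qed.

Section IncidenceVectors.
Context (R : realType) {n : nat}.
Implicit Types (e f g : {set 'I_n}) (D E : {set {set 'I_n}}).

(** Indexing the generators by vertex sets avoids choosing an order on the endpoints of an edge. *)
Definition ivec e : 'rV[R]_n := \row_i (i \in e)%:R.

Definition ivecs E : set 'rV[R]_n := [set ivec e | e in [set` E]].

Lemma ivec_inj : injective ivec.
Proof.
move=> e f /rowP ef; apply/setP => i; have := ef i; rewrite !mxE => /eqP.
by rewrite eqr_nat; do 2 case: (_ \in _).
Qed.

Lemma ivec2 i j : i != j -> ivec [set i; j]%SET = unit_vec R i + unit_vec R j.
Proof.
move=> ij; apply/rowP => k; rewrite !mxE !inE !eqxx /=.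
case: (eqVneq k i) => [->|_]; first by rewrite (negPf ij) addr0.
by rewrite add0r.
Qed.

Lemma dotp_ivec2 c i j : i != j -> dotp c (ivec [set i; j]%SET) = c 0 i + c 0 j.
Proof.
move=> ij; have E k : dotp c (unit_vec R k) = c 0 k.
  rewrite /dotp (bigD1 k)//= big1 => [|l lk]; rewrite !mxE ?eqxx ?mulr1 ?addr0//.
  by rewrite (negPf lk) andbF mulr0.
by rewrite ivec2// dotpD !E.
Qed.

(** At a coordinate where [e] and [f] differ, the 0/1 entry of [g] agrees with one of them, which
    forces [t] to be 0 or 1. *)
Lemma ivec_line e f g t : e != f ->
  ivec g - ivec e = t *: (ivec f - ivec e) -> g = e \/ g = f.
Proof.
move=> ef H.
have Hi i : (i \in g)%:R - (i \in e)%:R = t * ((i \in f)%:R - (i \in e)%:R).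
  by have /rowP/(_ i) := H; rewrite !mxE.
have [i ifNe] : exists i, (i \in f) != (i \in e).
  apply/existsP; apply: contraT; rewrite negb_exists => /forallP efE.
  case/eqP: ef; apply/setP => i; apply/eqP; rewrite eq_sym.
  by have := efE i; rewrite negbK.
have [t0|t1] : t = 0 \/ t = 1.
  have := Hi i; move: ifNe.
  by case: (i \in f); case: (i \in e); case: (i \in g) => //= _ ?;
    by [left; lra|right; lra].
- left; apply: ivec_inj; apply/eqP; rewrite -subr_eq0.
  by rewrite H t0 scale0r.
- right; apply: ivec_inj; apply/eqP; rewrite -subr_eq0.
  by move: H; rewrite t1 scale1r => /addIr ->; rewrite subrr.
Qed.

(** Points of the cube with 0/1 coordinates are its vertices: in each coordinate the value is
    extreme, so every generator of nonzero weight agrees with [ivec e] there. This lets [D] be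
    recovered from its hull. *)
Lemma conv_hull_ivec D e : conv_hull (ivecs D) (ivec e) -> e \in D.
Proof.
move=> [k [p [a [pD a0 a1 eE]]]].
have [i ai] : exists i, a i != 0.
  apply/existsP; apply: contraT; rewrite negb_exists => /forallP H.
  have := oner_neq0 R; rewrite -a1 big1 ?eqxx// => i _.
  by move: (H i); rewrite negbK => /eqP.
have [g gD gE] := pD i.
have pE j : exists g', p j = ivec g' by have [g' _ <-] := pD j; exists g'.
suff -> : e = g by [].
apply/setP => l; have := congr1 (fun v : 'rV_n => v 0 l) eE.
rewrite summxE !mxE; case: (boolP (l \in e)) => le /= H.
- have : \sum_j a j * (1 - p j 0 l) = 0.
    under eq_bigr => j _ do rewrite mulrBr mulr1.
    rewrite sumrB a1; apply/eqP; rewrite subr_eq0; apply/eqP.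
    by apply: etrans H _; apply: eq_bigr => j _; rewrite mxE.
  move/psumr_eq0P => /(_ _ i isT) H'.
  have /eqP : a i * (1 - p i 0 l) = 0.
    apply: H' => j _; rewrite mulr_ge0//.
    by have [g' ->] := pE j; rewrite mxE; case: (_ \in _) => /=; lra.
  rewrite mulf_eq0 (negPf ai) -gE mxE; case: (l \in g) => //= /eqP; lra.
- have /esym : 0 = \sum_j a j * p j 0 l.
    by apply: etrans H _; apply: eq_bigr => j _; rewrite mxE.
  move/psumr_eq0P => /(_ _ i isT) H'.
  have /eqP : a i * p i 0 l = 0.
    apply: H' => j _; rewrite mulr_ge0//.
    by have [g' ->] := pE j; rewrite mxE; case: (_ \in _) => /=; lra.
  rewrite mulf_eq0 (negPf ai) -gE mxE; case: (l \in g) => //= /eqP; lra.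
Qed.

Lemma edge_polytopeE E : {in E, forall e, #|e| = 2%N} ->
  edge_polytope R E = conv_hull (ivecs E).
Proof.
move=> E2; congr conv_hull; apply/seteqP; split=> x.
  move=> [i [j [ijE ->]]]; exists [set i; j]%SET => //; apply: ivec2.
  by have := E2 _ ijE; rewrite cards2; case: (i != j).
move=> [e eE <-]; have /eqP/cards2P[i [j [ij eij]]] := E2 _ eE.
by exists i, j; rewrite -eij -ivec2// -eij.
Qed.

Lemma ivecs2 e f : ivecs [set e; f]%SET = [set ivec e; ivec f].
Proof.
apply/seteqP; split=> x.
  by move=> [g]; rewrite /= !inE => /orP[] /eqP -> <-; [left|right].
by case=> ->; [exists e|exists f]; rewrite //= !inE eqxx ?orbT.
Qed.

End IncidenceVectors.

Arguments ivec R {n} e.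
Arguments ivecs R {n} E.

(** * The combinatorial criterion for a pair of edges to span a face *)

Section GoodPairs.
Context {n : nat}.
Implicit Types (e f g : {set 'I_n}) (D E : {set {set 'I_n}}).

(* [a b d c] is a 4-cycle through the disjoint pairs [ab] and [cd]; when [E]
   consists of 2-sets, membership of [ac] and [bd] gives [a != c] and [b != d]. *)
Definition crossed E (a b c d : 'I_n) :=
  [&& a != d, b != c, [set a; c]%SET \in E & [set b; d]%SET \in E].

(** Since [a], [b], [c], [d] run over all labellings of [D], both possible 4-cycles with the two
    edges of [D] opposite are excluded. *)
Definition good E D :=
  [&& D \subset E, #|D| == 2%N &
   [forall a, forall b, forall c, forall d,
     (D == [set [set a; b]; [set c; d]]%SET) ==> ~~ crossed E a b c d]].

Lemma goodP E D :
  reflect [/\ D \subset E, #|D| = 2%N &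
     forall a b c d, D = [set [set a; b]; [set c; d]]%SET -> ~~ crossed E a b c d]
    (good E D).
Proof.
apply: (iffP and3P) => -[DE /eqP D2 H]; split=> //.
- move=> a b c d DE'; move/forallP/(_ a)/forallP/(_ b)/forallP/(_ c): H.
  by move/forallP/(_ d)/implyP; apply; apply/eqP.
- apply/forallP => a; apply/forallP => b; apply/forallP => c; apply/forallP => d.
  by apply/implyP => /eqP; apply: H.
Qed.

End GoodPairs.

(** * One-dimensional faces correspond to good pairs *)

Section Faces.
Context (R : realType) {n : nat}.
Implicit Types (e f g : {set 'I_n}) (D E : {set {set 'I_n}}).
Local Notation ivec := (ivec R).
Local Notation ivecs := (ivecs R).

Lemma tight_ivecs E (c : 'rV[R]_n) b :
  ivecs E `&` [set x | dotp c x = b] =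
  ivecs [set e in E | dotp c (ivec e) == b]%SET.
Proof.
apply/seteqP; split=> x.
  by move=> [[e eE <-] /= /eqP eb]; exists e => //=; rewrite inE eb andbT.
by move=> [e /=]; rewrite inE => /andP[eE /eqP eb] <-; split=> //; exists e.
Qed.

(** A face is the hull of its tight generators. Dimension one requires at least two of them, and a
    third would be collinear with these, which 0/1 vectors do not allow. *)
Lemma one_face_good E F : {in E, forall e, #|e| = 2%N} ->
  face (conv_hull (ivecs E)) F -> has_dim F 1 ->
  exists2 D, good E D & F = conv_hull (ivecs D).
Proof.
move=> E2 [c [b [Pb FE]]] F1.
have Eb e : e \in E -> dotp c (ivec e) <= b.
  by move=> eE; apply: Pb; apply: conv_hull_gen; exists e.
rewrite conv_hull_hyperplane ?tight_ivecs in FE; last by move=> x [e /Eb + <-].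
set D := [set _ in _ | _]%SET in FE; exists D => //.
have inD e : (e \in D) = (e \in E) && (dotp c (ivec e) == b) by rewrite inE.
have DF e : e \in D -> F (ivec e).
  by move=> eD; rewrite FE; apply: conv_hull_gen; exists e.
have [e [eD [f [fD ef]]]] : exists e, e \in D /\ exists f, f \in D /\ e != f.
  apply: contrapT => H.
  have [z Dz] : exists z, ivecs D `<=` [set z].
    case: (set_0Vmem D) => [D0|[e eD]].
      by exists 0 => x [e]; rewrite /= D0 inE.
    exists (ivec e) => x [f fD <-]; rewrite /=; apply: contrapT => fe.
    apply: H; exists e; split=> //; exists f; split=> //.
    by apply/eqP => ef; apply: fe; rewrite ef.
  apply: (@has_dim1_nontrivial _ _ F z F1); rewrite FE => x [k [p [a [pD _ a1 ->]]]].
  rewrite /= -[RHS]scale1r -a1 scaler_suml.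
  by apply: eq_bigr => i _; rewrite (Dz _ (pD i)).
have DE : D = [set e; f]%SET.
  apply/setP => g; rewrite in_set2; apply/idP/orP; last by case=> /eqP ->.
  move=> gD; have [] := has_dim1_line F1 (DF _ eD) (DF _ fD) (DF _ gD).
    by apply: contraNneq ef => /ivec_inj ->.
  by move=> t /(ivec_line ef)[->|->]; [left|right].
apply/goodP; split.
- by apply/fintype.subsetP => g; rewrite inD => /andP[].
- by rewrite DE cards2 ef.
move=> a b' c' d DE'; apply/negP => /and4P[ad bc acE bdE].
have N2 i j : [set i; j]%SET \in E -> i != j.
  by move=> /E2; rewrite cards2; case: (i != j).
have abD : [set a; b']%SET \in D by rewrite DE' !inE eqxx.
have cdD : [set c'; d]%SET \in D by rewrite DE' !inE eqxx orbT.
move: (abD) (cdD); rewrite !inD => /andP[abE /eqP abb] /andP[cdE /eqP cdb].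
(* The pairs [ab'], [c'd] and [ac'], [b'd] have the same vector sum, so the values on [ac'] and
   [b'd] add up to [2b]; as neither exceeds [b], the edge [ac'] is tight too. *)
have : [set a; c']%SET \in D.
  rewrite inD acE /= eq_le Eb//=.
  move: abb cdb (Eb _ bdE) => <-; rewrite !dotp_ivec2 ?N2//.
  lra.
rewrite DE' in_set2 => /orP[] /eqP/set2_inj[] [? ?]; subst.
- by rewrite eqxx in bc.
- by have := N2 _ _ abE; rewrite eqxx.
- by have := N2 _ _ acE; rewrite eqxx.
- by rewrite eqxx in ad.
Qed.

Lemma separated_face E D (c : 'rV[R]_n) : D \subset E -> #|D| = 2%N ->
  {in D, forall e, dotp c (ivec e) = 0} ->
  {in E :\: D, forall e, dotp c (ivec e) < 0} ->
  face (conv_hull (ivecs E)) (conv_hull (ivecs D)) /\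
  has_dim (conv_hull (ivecs D)) 1.
Proof.
move=> DE /eqP/cards2P[e [f [ef DEf]]] D0 Dlt.
have Ele : ivecs E `<=` [set x | dotp c x <= 0].
  move=> x [g /= gE <-]; case: (boolP (g \in D)) => gD; first by rewrite D0.
  by apply: ltW; apply: Dlt; rewrite inE gD.
split; last first.
  rewrite DEf ivecs2; apply: has_dim_segment.
  by apply: contraNneq ef => /ivec_inj ->.
exists c, 0; split; first exact: conv_hull_halfspace.
rewrite conv_hull_hyperplane ?tight_ivecs//; congr (conv_hull (ivecs _)).
apply/setP => g; rewrite inE; apply/idP/andP.
  by move=> gD; rewrite (fintype.subsetP DE)// D0// eqxx.
move=> [gE /eqP g0]; apply: contraT => gD.
by have := Dlt g; rewrite inE gD gE g0 ltxx => /(_ isT).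
Qed.

Lemma disjoint_separated E (a b c d : 'I_n) :
  {in E, forall e, #|e| = 2%N} ->
  uniq [:: a; b; c; d] ->
  [set a; c]%SET \notin E -> [set a; d]%SET \notin E ->
  let D := [set [set a; b]; [set c; d]]%SET in
  exists w : 'rV[R]_n, {in D, forall e, dotp w (ivec e) = 0} /\
    {in E :\: D, forall e, dotp w (ivec e) < 0}.
Proof.
move=> E2; rewrite /= !inE !negb_or => /and4P[/and3P[ab ac ad] /andP[bc bd] cd _].
move=> acE adE.
exists (\row_i (if i == a then 1 else if i == b then -1
   else if (i == c) || (i == d) then 0 else -2)); split=> e.
  rewrite !inE => /orP[] /eqP ->; rewrite dotp_ivec2// !mxE !eqxx.
    by rewrite (eq_sym b) (negPf ab) subrr.
  rewrite (eq_sym c a) (eq_sym c b) (eq_sym d a) (eq_sym d b).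
  by rewrite (negPf ac) (negPf bc) (negPf ad) (negPf bd) orbT addr0.
rewrite !inE negb_or => /andP[/andP[eab ecd] eE].
have /eqP/cards2P[i [j [ij eij]]] := E2 _ eE.
rewrite eij dotp_ivec2// !mxE; rewrite {}eij in eE eab ecd.
case: (eqVneq i a) (eqVneq j a) => [ia|ia] [ja|ja]; subst.
- by rewrite eqxx in ij.
- case: (eqVneq j b) => [jb|jb]; first by rewrite jb eqxx in eab.
  case: (eqVneq j c) => [jc|jc]; first by rewrite jc (negPf acE) in eE.
  case: (eqVneq j d) => [jd|jd]; first by rewrite jd (negPf adE) in eE.
  by rewrite /=; lra.
- rewrite finset.setUC in eE eab ecd.
  case: (eqVneq i b) => [ib|ib]; first by rewrite ib eqxx in eab.
  case: (eqVneq i c) => [ic|ic]; first by rewrite ic (negPf acE) in eE.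
  case: (eqVneq i d) => [id_|id_]; first by rewrite id_ (negPf adE) in eE.
  by rewrite /=; lra.
(* Away from [a] all weights are at most 0, and the sum vanishes only if both endpoints lie in
   [{c, d}], that is, on the excluded edge [cd]. *)
- case: (boolP ((i == c) || (i == d))) => hi; last first.
    by do ?case: ifP => _; lra.
  case: (boolP ((j == c) || (j == d))) => hj; last first.
    by do ?case: ifP => _; lra.
  case/orP: hi ij ecd => /eqP ->; case/orP: hj => /eqP ->; rewrite ?eqxx//.
  by rewrite finset.setUC eqxx.
Qed.

(** Only [a] gets a positive weight, so edges avoiding [a] are negative, and among the edges at [a]
    only those to [b] and [c] reach 0, whatever else [E] contains. *)
Lemma adjacent_separated E (a b c : 'I_n) :
  {in E, forall e, #|e| = 2%N} -> uniq [:: a; b; c] ->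
  let D := [set [set a; b]; [set a; c]]%SET in
  exists w : 'rV[R]_n, {in D, forall e, dotp w (ivec e) = 0} /\
    {in E :\: D, forall e, dotp w (ivec e) < 0}.
Proof.
move=> E2; rewrite /= !inE !negb_or => /and3P[/andP[ab ac] bc _].
exists (\row_i (if i == a then 1 else if (i == b) || (i == c) then -1 else -2)).
split=> e.
  rewrite !inE => /orP[] /eqP ->; rewrite dotp_ivec2// !mxE !eqxx ?orbT.
    by rewrite (eq_sym b) (negPf ab) subrr.
  by rewrite (eq_sym c) (negPf ac) subrr.
rewrite !inE negb_or => /andP[/andP[eab eac] eE].
have /eqP/cards2P[i [j [ij eij]]] := E2 _ eE.
rewrite eij dotp_ivec2// !mxE; rewrite {}eij in eE eab eac.
case: (eqVneq i a) (eqVneq j a) => [ia|ia] [ja|ja]; subst.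
- by rewrite eqxx in ij.
- case: (eqVneq j b) => [jb|jb]; first by rewrite jb eqxx in eab.
  case: (eqVneq j c) => [jc|jc]; first by rewrite jc eqxx in eac.
  by rewrite /=; lra.
- rewrite finset.setUC in eE eab eac.
  case: (eqVneq i b) => [ib|ib]; first by rewrite ib eqxx in eab.
  case: (eqVneq i c) => [ic|ic]; first by rewrite ic eqxx in eac.
  by rewrite /=; lra.
- by do ?case: ifP => _; lra.
Qed.

Lemma good_separated E D : {in E, forall e, #|e| = 2%N} -> good E D ->
  exists w : 'rV[R]_n, {in D, forall e, dotp w (ivec e) = 0} /\
    {in E :\: D, forall e, dotp w (ivec e) < 0}.
Proof.
move=> E2 /goodP[DE /eqP/cards2P[e [f [ef DEf]]] Dgood]; subst.
have /eqP/cards2P[a [b [ab eE]]] : #|e| = 2%N.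
  by apply/E2/(fintype.subsetP DE); rewrite !inE eqxx.
have /eqP/cards2P[c [d [cd fE]]] : #|f| = 2%N.
  by apply/E2/(fintype.subsetP DE); rewrite !inE eqxx orbT.
subst.
have dc : d != c by rewrite eq_sym.
have ba : b != a by rewrite eq_sym.
case: (eqVneq a c) => [ac|ac].
  subst; apply: adjacent_separated => //=; rewrite !inE negb_or ab cd /= andbT.
  by apply: contraNneq ef => ->.
case: (eqVneq a d) => [ad|ad].
  subst; rewrite (finset.setUC [set c]%SET); apply: adjacent_separated => //=.
  by rewrite !inE negb_or ab dc /= andbT; apply: contraNneq ef => ->; rewrite finset.setUC.
case: (eqVneq b c) => [bc|bc].
  subst; rewrite (finset.setUC [set a]%SET); apply: adjacent_separated => //=.
  by rewrite !inE negb_or ba cd /= andbT.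
case: (eqVneq b d) => [bd|bd].
  subst; rewrite (finset.setUC [set a]%SET) (finset.setUC [set c]%SET).
  apply: adjacent_separated => //=.
  by rewrite !inE negb_or ba dc /= andbT.
have := Dgood a b c d erefl; have := Dgood a b d c.
rewrite /crossed (finset.setUC [set d]%SET) ac bd ad bc /= => /(_ erefl).
(* Each of the two 4-cycles lacks an edge. In all four combinations the two missing edges share a
   vertex, namely [a], [d], [c], [b] in turn, and that vertex takes the role of [a] in
   [disjoint_separated]. *)
rewrite !negb_and => /orP[] h1 /orP[] h2.
- by apply: disjoint_separated => //=; rewrite !inE !negb_or ab ac ad bc bd cd.
- rewrite (finset.setUC [set c]%SET) (finset.setUC [set [set a; b]%SET]).
  by apply: disjoint_separated; rewrite //= ?(finset.setUC [set d]%SET)// !inE !negb_or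
    (eq_sym c) (eq_sym d a) (eq_sym d b) ab ac ad dc (eq_sym c) bc bd.
- rewrite (finset.setUC [set [set a; b]%SET]).
  by apply: disjoint_separated; rewrite //= ?(finset.setUC [set c]%SET)// !inE !negb_or
    (eq_sym d) (eq_sym c a) (eq_sym c b) ab ac ad cd (eq_sym d) bc bd.
- rewrite (finset.setUC [set a]%SET).
  by apply: disjoint_separated; rewrite //= !inE !negb_or ba ac ad bc bd cd.
Qed.

(** Taking hulls is a bijection from good pairs to one-dimensional faces: onto by [one_face_good],
    well defined by [good_separated], injective by [conv_hull_ivec]. *)
Lemma f_vector1_good E : {in E, forall e, #|e| = 2%N} ->
  f_vector (edge_polytope R E) 1 = #|[set D | good E D]%SET|.
Proof.
move=> E2; rewrite /f_vector edge_polytopeE//.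
pose A := [fset D : {set {set 'I_n}} | good E D]%fset.
have inA D : (D \in A) = good E D.
  by rewrite in_fset.
have -> : [set F | face (conv_hull (ivecs E)) F /\ has_dim F 1] =
    [set` [fset conv_hull (ivecs D) | D in A]%fset].
  apply/seteqP; split=> F /=.
    move=> [FP F1]; have [D gD ->] := one_face_good E2 FP F1.
    by apply/imfsetP; exists D; rewrite //= inA.
  move=> /imfsetP[D /=]; rewrite inA => gD ->.
  have [w [w0 wlt]] := good_separated E2 gD.
  by have /goodP[DE D2 _] := gD; apply: separated_face w0 wlt.
rewrite set_fsetK.
have /card_in_imfsetP/eqP -> : {in A &, injective (fun D => conv_hull (ivecs D))}.
  move=> D D' _ _ DD'; apply/setP => e.
  by apply/idP/idP => eD; apply: (@conv_hull_ivec R);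
    [rewrite -DD'|rewrite DD']; apply: conv_hull_gen; exists e.
rewrite cardsE -card_finset; congr (#|` _|)%fset.
by apply/fsetP => D; rewrite inA in_fset.
Qed.

End Faces.

(** * Passing between unordered and ordered pairs *)

Lemma sum_ordered_pairs (V : nmodType) (T : finType) (F : {set T} -> V) :
  \sum_(p : T * T | p.1 != p.2) F [set p.1; p.2]%SET =
  (\sum_(D : {set T} | #|D| == 2%N) F D) *+ 2.
Proof.
rewrite (partition_big (fun p : T * T => [set p.1; p.2]%SET)
  (fun D => #|D| == 2%N)) /=; last by move=> p pp; rewrite cards2 pp.
rewrite -sumrMnl; apply: eq_bigr => D /cards2P[x [y [xy DE]]].
rewrite (eq_bigr (fun=> F D)) => [|p /andP[_ /eqP ->]//].
rewrite sumr_const; congr (_ *+ _).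
rewrite (@eq_card _ _ (mem [set (x, y); (y, x)]%SET)).
  by rewrite cards2 xpair_eqE (negPf xy).
move=> [u v]; rewrite !inE /= !xpair_eqE DE; apply/andP/orP.
  by move=> [uv /eqP/set2_inj/=[] [-> ->]]; rewrite !eqxx; [left|right].
by case=> /andP[/eqP -> /eqP ->]; rewrite ?(eq_sym y) xy finset.setUC ?eqxx//
  finset.setUC eqxx.
Qed.

Lemma sum_two_sets (V : nmodType) (T : finType) (F : {set T} -> V) :
  \sum_x \sum_(y | x != y) F [set x; y]%SET =
  (\sum_(D : {set T} | #|D| == 2%N) F D) *+ 2.
Proof. by rewrite -sum_ordered_pairs pair_big_dep. Qed.

Lemma good_count2 (R : pzSemiRingType) (n : nat) (E : {set {set 'I_n}}) :
  #|[set D | good E D]%SET|%:R *+ 2 =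
  \sum_e \sum_(f | e != f) (good E [set e; f]%SET)%:R :> R.
Proof.
rewrite (sum_two_sets (fun D => (good E D)%:R)); congr (_ *+ 2).
rewrite cardsE -sum1_card natr_sum big_mkcond [RHS]big_mkcond /=.
apply: eq_bigr => D _; rewrite -[_ \in good E]/(good E D).
by case: goodP => [[_ -> _]|_] //=; case: ifP.
Qed.

(** * Upper bound on the number of good pairs *)

Section UpperBound.
Context {R : realFieldType}.

(** Cauchy-Schwarz against the constant vector, by expanding the double sum of
    [(x i - x j) ^+ 2]. *)
Lemma sqr_sum_le (I : finType) (x : I -> R) :
  (\sum_i x i) ^+ 2 <= #|I|%:R * \sum_i x i ^+ 2.
Proof.
have : 0 <= \sum_i \sum_j (x i - x j) ^+ 2.
  by apply: sumr_ge0 => i _; apply: sumr_ge0 => j _; apply: sqr_ge0.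
rewrite (eq_bigr (fun i => #|I|%:R * x i ^+ 2 + \sum_j x j ^+ 2
    - 2 * x i * \sum_j x j)) => [|i _]; last first.
  rewrite (eq_bigr (fun j => x i ^+ 2 + x j ^+ 2 - 2 * x i * x j)) => [|j _].
    by rewrite sumrB big_split /= sumr_const -mulr_sumr -[x i ^+ 2 *+ _]mulr_natl.
  by ring.
rewrite sumrB big_split /= sumr_const -mulr_sumr -mulr_suml -mulr_sumr.
rewrite -[(\sum_i x i ^+ 2) *+ _]mulr_natl => h.
by rewrite expr2; lra.
Qed.

Context {n : nat} (E : {set {set 'I_n}}).
Context (E2 : {in E, forall e : {set 'I_n}, #|e| = 2%N}).

Let A (a b : 'I_n) : R := ([set a; b]%SET \in E)%:R.
Let Asym a b : A a b = A b a. Proof. by rewrite /A finset.setUC. Qed.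

(** A 4-cycle is a pair [b], [c] with two chosen common neighbours, so the count is the sum of
    squared codegrees. The codegrees add up to the sum of squared degrees, and Cauchy-Schwarz
    applies once to degrees and once to codegrees. *)
Lemma hom_C4_ge :
  (\sum_a \sum_b A a b) ^+ 4 <= n%:R ^+ 4 *
  \sum_a \sum_b \sum_c \sum_d A a b * A c d * (A a c * A b d).
Proof.
pose codeg b c := \sum_a A a b * A a c.
have -> : \sum_a \sum_b \sum_c \sum_d A a b * A c d * (A a c * A b d) =
    \sum_(p : 'I_n * 'I_n) codeg p.1 p.2 ^+ 2.
  rewrite -(pair_bigA _ (fun b c => codeg b c ^+ 2)) /= exchange_big /=.
  apply: eq_bigr => b _; rewrite exchange_big /=; apply: eq_bigr => c _.
  rewrite /codeg expr2 big_distrlr /=; apply: eq_bigr => a _; apply: eq_bigr => d _.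
  by rewrite (Asym c) (Asym b d); ring.
have codegE : \sum_(p : 'I_n * 'I_n) codeg p.1 p.2 = \sum_a (\sum_b A a b) ^+ 2.
  rewrite -(pair_bigA _ (fun b c => codeg b c)) /= /codeg.
  under eq_bigr => b _ do rewrite exchange_big.
  rewrite exchange_big; apply: eq_bigr => a _.
  by rewrite expr2 big_distrlr.
have h1 := sqr_sum_le (fun a => \sum_b A a b).
have h2 := sqr_sum_le (fun p : 'I_n * 'I_n => codeg p.1 p.2).
rewrite codegE card_prod card_ord in h2; rewrite card_ord in h1.
rewrite -[4%N]/(2 * 2)%N !exprM.
apply: le_trans (_ : (n%:R * \sum_a (\sum_b A a b) ^+ 2) ^+ 2 <= _).
  rewrite ler_sqr ?nnegrE ?sqr_ge0//.
  by apply: le_trans h1; apply: sqr_ge0.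
rewrite exprMn [leRHS](_ : _ = n%:R ^+ 2 * ((n * n)%:R *
  \sum_(p : 'I_n * 'I_n) codeg p.1 p.2 ^+ 2)); last by rewrite natrM; ring.
by apply: ler_wpM2l h2; apply: sqr_ge0.
Qed.

(* The last four terms absorb the pairs of edges that share a vertex. *)
Lemma good_indicator_le (a b c d : 'I_n) :
  (good E [set [set a; b]; [set c; d]]%SET)%:R <=
  A a b * A c d
  - (A a b * A c d * (A a c * A b d) + A a b * A c d * (A a d * A b c)) / 2
  + ((a == c)%:R + (a == d)%:R + (b == c)%:R + (b == d)%:R) :> R.
Proof.
have b0 (p : bool) : 0 <= p%:R :> R by [].
have b1 (p : bool) : p%:R <= 1 :> R by case: p.
have u1 : A a c * A b d <= 1 by rewrite mulr_ile1 ?b0 ?b1.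
have v1 : A a d * A b c <= 1 by rewrite mulr_ile1 ?b0 ?b1.
have := b0 (a == c); have := b0 (a == d); have := b0 (b == c); have := b0 (b == d).
case: goodP => [[DE _ H]|_]; last first.
  have : 0 <= A a b * A c d * (1 - (A a c * A b d + A a d * A b c) / 2).
    by rewrite !mulr_ge0 ?b0//; lra.
  by move=> /=; lra.
have -> : A a b = 1 by rewrite /A (fintype.subsetP DE)// !inE eqxx.
have -> : A c d = 1 by rewrite /A (fintype.subsetP DE)// !inE eqxx orbT.
(* A shared vertex adds 1 on the right, enough to offset the halved 4-cycle terms; for disjoint
   edges goodness makes both of these terms vanish. *)
case: eqVneq => [_|bd] /=; first lra.
case: eqVneq => [_|bc] /=; first lra.
case: eqVneq => [_|ad] /=; first lra.
case: eqVneq => [_|ac] /=; first lra.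
have := H a b c d erefl; have := H a b d c.
rewrite (finset.setUC [set d]%SET) /crossed ac ad bc bd /= => /(_ erefl) v0 u0.
have -> : A a d * A b c = 0 by rewrite /A -natrM mulnb (negPf v0).
have -> : A a c * A b d = 0 by rewrite /A -natrM mulnb (negPf u0).
lra.
Qed.

Lemma good_count_le : (0 < n)%N ->
  #|[set D | good E D]%SET|%:R <= n%:R ^+ 4 / 32 + n%:R ^+ 3 / 2 :> R.
Proof.
move=> n_gt0; set S := \sum_a \sum_b A a b.
set Q := \sum_a \sum_b \sum_c \sum_d A a b * A c d * (A a c * A b d).
pose g D : R := (good E D)%:R.
have g0 D : 0 <= g D by [].
have h1 : #|[set D | good E D]%SET|%:R *+ 2 <=
    \sum_(e : {set 'I_n} | #|e| == 2%N) \sum_(f : {set 'I_n} | #|f| == 2%N)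
      g [set e; f]%SET.
  rewrite good_count2 [leRHS]big_mkcond; apply: ler_sum => e _ /=.
  case: ifPn => e2; last first.
    rewrite big1// => f _; rewrite /g; case: goodP => // -[/fintype.subsetP DE _ _].
    by move: e2; rewrite E2 ?DE// !inE eqxx.
  rewrite big_mkcond [leRHS]big_mkcond; apply: ler_sum => f _ /=.
  case: ifPn => _; case: ifPn => // f2.
  rewrite /g; case: goodP => // -[/fintype.subsetP DE _ _].
  by move: f2; rewrite E2 ?DE// !inE eqxx orbT.
have h2 : (\sum_(e : {set 'I_n} | #|e| == 2%N) \sum_(f : {set 'I_n} | #|f| == 2%N)
      g [set e; f]%SET) *+ 4 =
    \sum_a \sum_(b | a != b) \sum_c \sum_(d | c != d)
      g [set [set a; b]; [set c; d]]%SET.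
  rewrite (mulrnA _ 2 2) -sum_two_sets -sumrMnl.
  apply: eq_bigr => a _; rewrite -sumrMnl; apply: eq_bigr => b _.
  by rewrite -sum_two_sets.
(* The bound of [good_indicator_le] is nonnegative for all [a], [b], [c], [d], so the degenerate
   terms [a = b] and [c = d] may be added. *)
have h3 : \sum_a \sum_(b | a != b) \sum_c \sum_(d | c != d)
      g [set [set a; b]; [set c; d]]%SET <=
   \sum_a \sum_b \sum_c \sum_d (A a b * A c d
  - (A a b * A c d * (A a c * A b d) + A a b * A c d * (A a d * A b c)) / 2
  + ((a == c)%:R + (a == d)%:R + (b == c)%:R + (b == d)%:R)).
  apply: ler_sum => a _; rewrite big_mkcond; apply: ler_sum => b _ /=.
  apply: le_trans (_ : \sum_c \sum_(d | c != d)
    g [set [set a; b]; [set c; d]]%SET <= _).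
    by case: ifP => // _; apply: sumr_ge0 => c _; apply: sumr_ge0.
  apply: ler_sum => c _; rewrite big_mkcond; apply: ler_sum => d _ /=.
  by apply: le_trans (good_indicator_le a b c d); case: ifP.
have sum_eq1 (a : 'I_n) : \sum_(c : 'I_n) (a == c)%:R = 1 :> R.
  rewrite (bigD1 a)//= eqxx big1 ?addr0// => c.
  by rewrite eq_sym => /negPf ->.
have sum_n (x : R) : \sum_(c : 'I_n) x = n%:R * x.
  by rewrite sumr_const card_ord mulr_natl.
(* Exchanging [c] and [d] shows that both 4-cycle terms sum to [Q], and each of the four equality
   indicators sums to [n ^ 3]. *)
have h4 : \sum_a \sum_b \sum_c \sum_d (A a b * A c d
  - (A a b * A c d * (A a c * A b d) + A a b * A c d * (A a d * A b c)) / 2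
  + ((a == c)%:R + (a == d)%:R + (b == c)%:R + (b == d)%:R)) =
  S ^+ 2 - Q + 4 * n%:R ^+ 3.
  have QE : Q = \sum_a \sum_b \sum_c \sum_d A a b * A c d * (A a d * A b c).
    apply: eq_bigr => a _; apply: eq_bigr => b _; rewrite exchange_big.
    apply: eq_bigr => c _; apply: eq_bigr => d _; rewrite (Asym c d); ring.
  have SE : S ^+ 2 = \sum_a \sum_b \sum_c \sum_d A a b * A c d.
    rewrite expr2 mulr_suml; apply: eq_bigr => a _.
    rewrite mulr_suml; apply: eq_bigr => b _.
    by rewrite mulr_sumr; apply: eq_bigr => c _; rewrite mulr_sumr.
  have -> : S ^+ 2 - Q = S ^+ 2 - (Q + Q) / 2 by lra.
  rewrite SE {1}/Q {1}QE.
  have -> : 4 * n%:R ^+ 3 = \sum_(a : 'I_n) \sum_(b : 'I_n) \sum_(c : 'I_n) \sum_(d : 'I_n)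
      ((a == c)%:R + (a == d)%:R + (b == c)%:R + (b == d)%:R) :> R.
    rewrite (eq_bigr (fun=> n%:R * (4 * n%:R))) ?sum_n => [|a _]; first by ring.
    rewrite (eq_bigr (fun=> 4 * n%:R)) ?sum_n// => b _.
    under eq_bigr => c _ do rewrite !big_split /= !sum_n !sum_eq1.
    rewrite !big_split /= -!mulr_sumr !sum_eq1 !sum_n; ring.
  rewrite -!big_split mulr_suml -sumrN -!big_split; apply: eq_bigr => a _.
  rewrite -!big_split mulr_suml -sumrN -!big_split; apply: eq_bigr => b _.
  rewrite -!big_split mulr_suml -sumrN -!big_split; apply: eq_bigr => c _.
  by rewrite -!big_split mulr_suml -sumrN -!big_split; apply: eq_bigr => d _.
(* With [N] the fourth power of [n] and [s = S ^+ 2], the 4-cycle bound reads [s ^+ 2 <= N * Q], and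
   [N * s - s ^+ 2 <= N ^+ 2 / 4] by completing the square. *)
have h5 : S ^+ 2 - Q <= n%:R ^+ 4 / 4.
  have N0 : 0 < n%:R ^+ 4 :> R by rewrite exprn_gt0// ltr0n.
  have := hom_C4_ge; rewrite -/S -/Q => h.
  rewrite -(ler_pM2l N0) mulrBr.
  have : 0 <= (S ^+ 2 - n%:R ^+ 4 / 2) ^+ 2 by apply: sqr_ge0.
  rewrite (exprM _ 2 2) in h.
  by move: h; set N := n%:R ^+ 4; set s := S ^+ 2; rewrite !expr2 => h; nra.
have : #|[set D | good E D]%SET|%:R *+ 8 <= n%:R ^+ 4 / 4 + 4 * n%:R ^+ 3 :> R.
  rewrite -[8%N]/(2 * 4)%N mulrnA.
  apply: le_trans (ler_wMn2r 4 h1) _; rewrite h2 (le_trans h3)// h4.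
  by rewrite lerD2r.
by rewrite -mulr_natl; lra.
Qed.

End UpperBound.

(** * Random subsets with independent membership *)

Section RandomSet.
Context {R : comNzRingType} (T : finType) (p : R).

(** For [p] in the unit interval, the probability that the random set equals [J]. *)
Definition bernoulli_weight (J : {set T}) : R :=
  \prod_i (if i \in J then p else 1 - p).

(** Replacing [1 - p] by 0 on [A] kills exactly the sets missing a point of [A]; by distributivity
    the remaining sum is a product with factor [p] on [A] and 1 elsewhere. *)
Lemma sum_bernoulli_superset (A : {set T}) :
  \sum_J bernoulli_weight J * (A \subset J)%:R = p ^+ #|A|.
Proof.
have : \prod_i (p + (if i \in A then 0 else 1 - p)) =
    \sum_(J : {set T}) \prod_i (if i \in J then p else if i \in A then 0 else 1 - p).
  exact: bigA_distr.
rewrite (eq_bigr (fun i => if i \in A then p else 1)) => [|i _]; last first.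
  by case: ifP => _; rewrite ?addr0 // addrC subrK.
rewrite -big_mkcond prodr_const => ->; apply: eq_bigr => J _.
case: (boolP (A \subset J)) => [AJ|/subsetPn[i iA iJ]].
  rewrite mulr1; apply: eq_bigr => i _; case: ifPn => // iJ.
  by rewrite ifN//; apply: contra iJ => /(fintype.subsetP AJ).
by rewrite mulr0 (bigD1 i)//= (negPf iJ) iA mul0r.
Qed.

Lemma sum_bernoulli : \sum_J bernoulli_weight J = 1.
Proof.
rewrite -[RHS](expr0 p) -(@cards0 T) -sum_bernoulli_superset.
by apply: eq_bigr => J _; rewrite finset.sub0set mulr1.
Qed.

End RandomSet.

(** * Lower bound by a random graph *)

Section LowerBound.
Context {n : nat}.
Implicit Types (e f : {set 'I_n}) (D E J : {set {set 'I_n}}).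

(** The random family [J] ranges over all sets of vertex sets, so that the product measure lives on
    a plain finite type; its two-element members form the random graph. *)
Definition two_sets J := [set e in J | #|e| == 2%N]%SET.

Lemma two_sets_card J : {in two_sets J, forall e, #|e| = 2%N}.
Proof. by move=> e; rewrite inE => /andP[_ /eqP]. Qed.

(** Each of the eight labellings of the pair closes up through one of the two other perfect
    matchings of [a], [b], [c], [d]. *)
Lemma good_disjoint J (a b c d : 'I_n) : uniq [:: a; b; c; d] ->
  [set [set a; b]; [set c; d]]%SET \subset J ->
  ~~ ([set [set a; c]; [set b; d]]%SET \subset J) ->
  ~~ ([set [set a; d]; [set b; c]]%SET \subset J) ->
  good (two_sets J) [set [set a; b]; [set c; d]]%SET.
Proof.
rewrite /= !inE !negb_or => /and4P[/and3P[ab ac ad] /andP[bc bd] cd _].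
rewrite !finset.subUset !finset.sub1set => /andP[abJ cdJ] N1 N2.
apply/goodP; split.
- by rewrite finset.subUset !finset.sub1set !inE abJ cdJ !cards2 ab cd.
- rewrite cards2; case: eqVneq => // /set2_inj[] [aE bE].
    by rewrite aE eqxx in ac.
  by rewrite aE eqxx in ad.
move=> a' b' c' d' /esym H; apply/negP => /and4P[_ _].
rewrite !inE => /andP[+ _] /andP[+ _].
have CA := finset.setUC [set c]%SET [set a]%SET.
have CB := finset.setUC [set c]%SET [set b]%SET.
have DA := finset.setUC [set d]%SET [set a]%SET.
have DB := finset.setUC [set d]%SET [set b]%SET.
case/set2_inj: H => -[/set2_inj[] [-> ->] /set2_inj[] [-> ->]];
  rewrite ?CA ?CB ?DA ?DB => h1 h2; move: N1 N2; by rewrite h1 h2 ?andbF.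
Qed.

(** Opposite edges of a 4-cycle are disjoint, so edges that meet are never crossed. *)
Lemma good_adjacent J e f : #|e| = 2%N -> #|f| = 2%N -> e != f ->
  ~~ (f \subset ~: e) -> [set e; f]%SET \subset J ->
  good (two_sets J) [set e; f]%SET.
Proof.
move=> e2 f2 ef meet.
rewrite !finset.subUset !finset.sub1set => /andP[eJ fJ].
apply/goodP; split.
- by rewrite finset.subUset !finset.sub1set !inE eJ fJ e2 f2.
- by rewrite cards2 ef.
move=> a b c d H; apply/negP => /and4P[ad bc /two_sets_card + /two_sets_card].
rewrite !cards2; case: (eqVneq a c) => // ac _; case: (eqVneq b d) => // bd _.
case/negP: meet; case/set2_inj: H => -[-> ->];
  rewrite finset.subUset !finset.sub1set !inE !negb_or;
  by rewrite ?(eq_sym c) ?(eq_sym d) ac ad bc bd.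
Qed.

(* A new edge has an endpoint isolated in [E], so it closes no 4-cycle through
   two edges of [E]. *)
Lemma good_extends_to_graph E : {in E, forall e, #|e| = 2%N} -> E != finset.set0 ->
  exists2 E', is_graph E' & forall D, good E D -> good E' D.
Proof.
move=> E2 /set0Pn[e0 e0E].
have /eqP/cards2P[u [u' [uu' e0E']]] := E2 _ e0E.
pose cov v := [exists e in E, v \in e].
have covu : cov u by apply/existsP; exists e0; rewrite e0E e0E' !inE eqxx.
pose E' := (E :|: [set [set v; u]%SET | v in [pred v | ~~ cov v]])%SET.
have E'2 e : e \in E' -> #|e| = 2%N.
  rewrite inE => /orP[/E2//|/imsetP[v]]; rewrite inE => cv ->.
  by rewrite cards2; case: eqVneq => // vu; rewrite vu covu in cv.
exists E'.
  apply/andP; split; first by apply/forall_inP => e /E'2/eqP.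
  apply/forallP => v; case: (boolP (cov v)) => [/exists_inP[e eE ve]|cv].
    by apply/exists_inP; exists e; rewrite // inE eE.
  apply/exists_inP; exists [set v; u]%SET; last by rewrite !inE eqxx.
  by rewrite inE; apply/orP; right; apply/imsetP; exists v.
have covE x y : cov x -> cov y -> [set x; y]%SET \in E' -> [set x; y]%SET \in E.
  move=> cx cy; rewrite inE => /orP[//|/imsetP[v]]; rewrite inE => cv.
  by move=> /set2_inj[] [xE yE]; [rewrite -xE cx in cv|rewrite -yE cy in cv].
move=> D /goodP[DE D2 H]; apply/goodP; split=> //.
  by apply: fintype.subset_trans DE _; apply: finset.subsetUl.
move=> a b c d DE'; have := H _ _ _ _ DE'; apply: contra => /and4P[ad bc ac bd].
have abE : [set a; b]%SET \in E by apply: (fintype.subsetP DE); rewrite DE' !inE eqxx.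
have cdE : [set c; d]%SET \in E by apply: (fintype.subsetP DE); rewrite DE' !inE eqxx orbT.
have [ca cb] : cov a /\ cov b.
  by split; apply/exists_inP; exists [set a; b]%SET; rewrite // !inE eqxx ?orbT.
have [cc cd] : cov c /\ cov d.
  by split; apply/exists_inP; exists [set c; d]%SET; rewrite // !inE eqxx ?orbT.
by rewrite /crossed ad bc !covE.
Qed.

Lemma good_count_le_max_edges (R : realType) J :
  (#|[set D | good (two_sets J) D]%SET| <= max_edges R n)%N.
Proof.
(* With no edge there is no covered vertex to hang the isolated ones on, but there is no good pair
   either. *)
case: (eqVneq (two_sets J) finset.set0) => [->|J0].
  rewrite (_ : [set D | _]%SET = finset.set0) ?cards0//.
  apply/setP => D; rewrite !inE; apply/negbTE/negP => /goodP[+ + _].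
  by rewrite finset.subset0 => /eqP ->; rewrite cards0.
have [E' gE' sub] := good_extends_to_graph (@two_sets_card J) J0.
have E'2 : {in E', forall e, #|e| = 2%N}.
  by move=> e eE'; case/andP: gE' => /forall_inP/(_ _ eE')/eqP.
apply: leq_trans (leq_bigmax_cond _ gE'); rewrite f_vector1_good//.
by apply: subset_leq_card; apply/fintype.subsetP => D; rewrite !inE; apply: sub.
Qed.

(** * Expected number of good pairs *)

Section Expectation.
Context {R : realFieldType} (p : R).
Context (p0 : 0 <= p) (p1 : p <= 1) (p3 : p ^+ 2 = 1 / 3).
Let w := @bernoulli_weight R {set 'I_n} p.

Lemma weight_ge0 J : 0 <= w J.
Proof. by apply: prodr_ge0 => e _; case: ifP => // _; rewrite subr_ge0. Qed.

Lemma prob_adjacent e f : #|e| = 2%N -> #|f| = 2%N -> e != f ->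
  ~~ (f \subset ~: e) ->
  1 / 3 <= \sum_J w J * (good (two_sets J) [set e; f]%SET)%:R.
Proof.
move=> e2 f2 ef meet.
have <- : \sum_J w J * ([set e; f]%SET \subset J)%:R = 1 / 3.
  by rewrite sum_bernoulli_superset cards2 ef.
apply: ler_sum => J _; apply: ler_wpM2l; first exact: weight_ge0.
case: (boolP ([set e; f]%SET \subset J)) => // efJ.
by rewrite good_adjacent.
Qed.

(** Inclusion-exclusion over the three perfect matchings [M1], [M2], [M3] of the four vertices gives
    [p^2 - 2p^4 + p^6], that is [x(1-x)^2] at [x = p^2]; the value [1/3] maximises this on the unit
    interval. *)
Lemma prob_disjoint e f : #|e| = 2%N -> #|f| = 2%N -> f \subset ~: e ->
  4 / 27 <= \sum_J w J * (good (two_sets J) [set e; f]%SET)%:R.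
Proof.
move=> /eqP/cards2P[a [b [ab ->]]] /eqP/cards2P[c [d [cd ->]]].
rewrite finset.subUset !finset.sub1set !inE !negb_or.
rewrite (eq_sym c a) (eq_sym c b) (eq_sym d a) (eq_sym d b).
move=> /andP[/andP[ac bc] /andP[ad bd]].
pose M1 := [set [set a; b]; [set c; d]]%SET.
pose M2 := [set [set a; c]; [set b; d]]%SET.
pose M3 := [set [set a; d]; [set b; c]]%SET.
have U : uniq [:: [set a; b]; [set c; d]; [set a; c]; [set b; d]; [set a; d]; [set b; c]]%SET.
  rewrite /= !inE !negb_or; do ?[apply/andP; split] => //;
    by apply/eqP => /set2_inj[] [h1 h2]; move: ab ac ad bc bd cd;
      rewrite ?h1 ?h2 ?eqxx.
have cardU (s : seq {set 'I_n}) (A : {set {set 'I_n}}) :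
    uniq s -> A =i s -> #|A| = size s.
  by move=> /card_uniqP <-; apply: eq_card.
have c1 : #|M1| = 2%N.
  apply: (@cardU [:: [set a; b]; [set c; d]]%SET); first exact: (mask_uniq U [:: true; true]).
  by move=> x; rewrite !inE.
have c2 : #|M1 :|: M2| = 4%N.
  apply: (@cardU [:: [set a; b]; [set c; d]; [set a; c]; [set b; d]]%SET).
    exact: (mask_uniq U [:: true; true; true; true]).
  by move=> x; rewrite !inE -!orbA.
have c3 : #|M1 :|: M3| = 4%N.
  apply: (@cardU [:: [set a; b]; [set c; d]; [set a; d]; [set b; c]]%SET).
    exact: (mask_uniq U [:: true; true; false; false; true; true]).
  by move=> x; rewrite !inE -!orbA.
have c4 : #|M1 :|: M2 :|: M3| = 6%N.
  by apply: (cardU _ _ U) => x; rewrite !inE -!orbA.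
have -> : 4 / 27 = \sum_J w J * ((M1 \subset J)%:R - (M1 :|: M2 \subset J)%:R
    - (M1 :|: M3 \subset J)%:R + (M1 :|: M2 :|: M3 \subset J)%:R) :> R.
  under eq_bigr => J _ do rewrite mulrDr !mulrBr.
  rewrite big_split /= !sumrB !sum_bernoulli_superset c1 c2 c3 c4.
  by rewrite (exprM p 2 2) (exprM p 2 3) p3; field.
apply: ler_sum => J _; apply: ler_wpM2l; first exact: weight_ge0.
rewrite (finset.subUset J (M1 :|: M2)) (finset.subUset J M1 M2) (finset.subUset J M1 M3).
have := ler0n R (good (two_sets J) M1).
case: (boolP (M1 \subset J)) => [h1|_] /=; last lra.
case: (boolP (M2 \subset J)) => [_|h2] /=; first by case: (M3 \subset J) => /=; lra.
case: (boolP (M3 \subset J)) => [_|h3] /=; first lra.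
rewrite good_disjoint//= ?inE ?negb_or ?ab ?ac ?ad ?bc ?bd ?cd//; lra.
Qed.

Lemma natr_bin2 m : 'C(m, 2)%:R = m%:R * (m%:R - 1) / 2 :> R.
Proof.
elim: m => [|m IHm]; first by rewrite bin0n mul0r mul0r.
by rewrite binS bin1 natrD IHm -natr1; field.
Qed.

Lemma card_disjoint_two_sets e : #|e| = 2%N ->
  #|[set f : {set 'I_n} | (f \subset ~: e) && (#|f| == 2%N)]%SET| = 'C(n - 2, 2).
Proof. by move=> e2; rewrite cards_draws cardsCs finset.setCK e2 card_ord. Qed.

Lemma sum_prob_ge e : #|e| = 2%N ->
  ('C(n, 2)%:R - 1) / 3 - 5 / 27 * 'C(n - 2, 2)%:R <=
  \sum_(f | e != f) \sum_J w J * (good (two_sets J) [set e; f]%SET)%:R.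
Proof.
move=> e2.
(* Every pair other than [e] counts [1/3], and a disjoint one loses [5/27], the gap between [1/3]
   and [4/27]. *)
have -> : ('C(n, 2)%:R - 1) / 3 - 5 / 27 * 'C(n - 2, 2)%:R =
    \sum_(f : {set 'I_n} | (e != f) && (#|f| == 2%N))
      (1 / 3 - 5 / 27 * (f \subset ~: e)%:R) :> R.
  rewrite sumrB -[X in _ = _ - X]mulr_sumr -(card_disjoint_two_sets e2) -sum1_card natr_sum.
  congr (_ - _ * _).
    have := card_draws 'I_n 2; rewrite card_ord => <-.
    rewrite sumr_const (cardsD1 e) inE e2 eqxx natrD addrAC subrr add0r mul1r.
    rewrite -[RHS]mulr_natl; congr (_%:R / _); apply: eq_card => f.
    by rewrite !inE eq_sym.
  rewrite [LHS]big_mkcond [RHS]big_mkcond; apply: eq_bigr => f _; rewrite inE.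
  case: (boolP (f \subset ~: e)) => fe; last by rewrite if_same.
  case: (eqVneq e f) => [ef|] //=.
  have /set0Pn[x xe] : e != finset.set0 by rewrite -card_gt0 e2.
  by have := fintype.subsetP fe x; rewrite -ef inE xe => /(_ isT).
rewrite [leRHS]big_mkcond [leLHS]big_mkcond; apply: ler_sum => f _ /=.
have sum0 : 0 <= \sum_J w J * (good (two_sets J) [set e; f]%SET)%:R.
  by apply: sumr_ge0 => J _; rewrite mulr_ge0// weight_ge0.
case: ifP => [/andP[ef /eqP f2]|_]; last by case: ifP.
rewrite ef; case: (boolP (f \subset ~: e)) => fe.
  by apply: le_trans (prob_disjoint e2 f2 fe); rewrite /=; lra.
by apply: le_trans (prob_adjacent e2 f2 ef fe); rewrite /=; lra.
Qed.

Lemma expected_good_count :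
  'C(n, 2)%:R * (('C(n, 2)%:R - 1) / 3 - 5 / 27 * 'C(n - 2, 2)%:R) / 2 <=
  \sum_J w J * #|[set D | good (two_sets J) D]%SET|%:R.
Proof.
suff : 'C(n, 2)%:R * (('C(n, 2)%:R - 1) / 3 - 5 / 27 * 'C(n - 2, 2)%:R) <=
    (\sum_J w J * #|[set D | good (two_sets J) D]%SET|%:R) *+ 2.
  by rewrite -mulr_natl; lra.
rewrite -sumrMnl.
under eq_bigr => J _ do rewrite -mulrnAr good_count2 mulr_sumr.
rewrite exchange_big /=.
have := card_draws 'I_n 2; rewrite card_ord => {1}<-.
rewrite mulr_natl -sumr_const [leLHS]big_mkcond; apply: ler_sum => e _ /=.
rewrite inE; under eq_bigr => J _ do rewrite mulr_sumr.
rewrite exchange_big /=; case: eqP => e2; first exact: sum_prob_ge.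
apply: sumr_ge0 => f _; apply: sumr_ge0 => J _.
by rewrite mulr_ge0// weight_ge0.
Qed.

End Expectation.

Lemma max_edges_ge (R : realType) : (2 <= n)%N ->
  n%:R * (n%:R - 1) * (n%:R - 2) * (n%:R + 6) / 54 <= (max_edges R n)%:R :> R.
Proof.
move=> n2; pose p : R := Num.sqrt (1 / 3).
have p0 : 0 <= p by apply: sqrtr_ge0.
have p3 : p ^+ 2 = 1 / 3 by rewrite sqr_sqrtr//; lra.
have p1 : p <= 1 by rewrite -(@ler_sqr R) ?nnegrE// p3; lra.
apply: le_trans (_ : \sum_J bernoulli_weight p J *
  #|[set D : {set {set 'I_n}} | good (two_sets J) D]%SET|%:R <= _).
  apply: le_trans (expected_good_count p0 p1 p3).
  by rewrite !natr_bin2 natrB//; lra.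
(* The weights are nonnegative and sum to 1, so the average over [J] is at most the maximum. *)
have -> : (max_edges R n)%:R =
    \sum_(J : {set {set 'I_n}}) bernoulli_weight p J * (max_edges R n)%:R.
  by rewrite -mulr_suml (sum_bernoulli {set 'I_n}) mul1r.
apply: ler_sum => J _.
apply: ler_wpM2l; first exact: weight_ge0.
by rewrite ler_nat good_count_le_max_edges.
Qed.

Lemma max_edges_le (R : realType) : (0 < n)%N ->
  (max_edges R n)%:R <= n%:R ^+ 4 / 32 + n%:R ^+ 3 / 2 :> R.
Proof.
move=> n0; have B0 : 0 <= n%:R ^+ 4 / 32 + n%:R ^+ 3 / 2 :> R.
  by rewrite addr_ge0// mulr_ge0// ?exprn_ge0// invr_ge0.
rewrite /max_edges; elim/big_ind: _ => [//|x y xB yB|E gE].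
  by rewrite /maxn; case: ifP.
have E2 : {in E, forall e, #|e| = 2%N}.
  by move=> e eE; case/andP: gE => /forall_inP/(_ _ eE)/eqP.
by rewrite f_vector1_good// good_count_le.
Qed.

End LowerBound.

Theorem theorem3p5 (R : realType) :
  exists eps : nat -> R,
    eps @ \oo --> (0 : R) /\
    forall n : nat, (6 <= n)%N ->
      (1 / 54 : R) * n%:R ^+ 4 <= (max_edges R n)%:R /\
      (max_edges R n)%:R <= (1 / 32 + eps n) * n%:R ^+ 4.
Proof.
(* The error is [1/(n+1)]: the excess [n^3/2] is at most [n^4/(n+1)] as soon as [n + 1 <= 2n]. *)
exists harmonic; split; first exact: cvg_harmonic.
move=> n n6; have N6 : 6 <= n%:R :> R by rewrite (ler_nat _ 6).
split.
  apply: le_trans (max_edges_ge R _); last exact: leq_trans n6.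
  set x : R := n%:R in N6 *.
  have -> : 1 / 54 * x ^+ 4 = x * x ^+ 3 / 54 by ring.
  (* The cubic is arranged so that its excess over [x ^+ 3] is visibly positive for [x] at least
     6. *)
  have -> : x * (x - 1) * (x - 2) * (x + 6) / 54 =
    x * (x ^+ 3 + (3 * x * (x - 6) + 2 * x + 12)) / 54 by ring.
  rewrite ler_pM2r ?invr_gt0// ler_pM2l; last lra.
  by rewrite lerDl; nra.
apply: le_trans (max_edges_le R _) _; first exact: leq_trans n6.
rewrite mulrDl mul1r mulrC lerD2l /harmonic /=.
rewrite ler_pdivlMl ?ltr0n// -natr1.
by rewrite [n%:R ^+ 4]exprS; have := exprn_ge0 3 (ler0n R n); nra.
Qed.
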